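(* Let $F$ be a divisibly closed supertropical semifield. Every polynomial $f\in F\lfloor\lambda\rfloor$ in one indeterminate which is not a tangible monomial has a strictly tangible root.
   Context: All semirings are commutative (in both operations), with zero $0_R$ and unit $1_R$. A supertropical semiring is a triple $(R,\mathcal G_0,\nu)$ where $R$ is a semiring, $\mathcal G_0=\mathcal G\cup\{0_R\}$ is a semiring ideal of $R$ (the ghost ideal), and $\nu:R\to\mathcal G_0$ (written $a^\nu=\nu(a)$) is a semiring homomorphism with $\nu^2=\nu$ (where $\mathcal G_0$ is a semiring with unit $\nu(1_R)$), such that: $a+a=a^\nu$ for all $a$; $a+b\in\{a,b\}$ whenever $a^\nu\ne b^\nu$; and $a+b=a^\nu$ whenever $a^\nu=b^\nu$. It is a supertropical domain if the set $\mathcal T=R\setminus\mathcal G_0$ of tangible elements is a multiplicative monoid and $\nu|_{\mathcal T}:\mathcal T\to\mathcal G$ is onto; it is a supertropical semifield if moreover $\mathcal T$ is an Abelian group. The divisible closure $\bar R$ of a supertropical domain $R$ consists of formal roots $\sqrt[m]{a}$ ($a\in R$, $m\ge1$), with $\sqrt[m]{a}=\sqrt[m']{b}$ when $a^{m'n}=b^{mn}$ for some $n\ge 1$, product $\sqrt[m]{a}\sqrt[m']{b}=\sqrt[mm']{a^{m'}b^m}$, sum $\sqrt[m]{a}+\sqrt[m']{b}=\sqrt[mm']{a^{m'}+b^m}$, and $\nu(\sqrt[m]{a})=\sqrt[m]{a^\nu}$. $R$ is divisibly closed if $\bar R=R$ (identifying $a$ with $\sqrt[1]{a}$). $F\lfloor\lambda\rfloor$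 is the semiring of formal polynomials $\sum_i\alpha_i\lambda^i$. A tangible monomial is $\alpha\lambda^i$ with $\alpha\in\mathcal T$, $i\ge0$. An element $a\in F$ is a root of $f$ if $f(a)\in\mathcal G_0$; it is strictly tangible if $a\in\mathcal T$. *)

(* Defs.v *)
From mathcomp Require Import all_boot all_order all_algebra.
From mathcomp Require Import generic_quotient.
From mathcomp Require Import boolp ring.

Set Implicit Arguments.
Unset Strict Implicit.
Unset Printing Implicit Defensive.

Import GRing.Theory.

Local Open Scope ring_scope.
Local Open Scope quotient_scope.

(* The triple (R, G_0, nu): [G0] is the ghost ideal, and [nu] : R -> G_0 is
   encoded as a self-map of R with values in [G0].  As a semiring in its own
   right, G_0 has unit [nu 1], whence [supertropical_unit]; that [nu] preserves
   units is then automatic. *)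
Record supertropical_semiring (R : comPzSemiRingType)
    (G0 : {pred R}) (nu : R -> R) : Prop := SupertropicalSemiring {
  supertropical_ideal0 : 0 \in G0;
  supertropical_idealD : {in G0 &, forall a b, a + b \in G0};
  supertropical_idealM : forall r, {in G0, forall a, r * a \in G0};
  supertropical_nu_ghost : forall a, nu a \in G0;
  supertropical_unit : {in G0, forall a, nu 1 * a = a};
  supertropical_nu0 : nu 0 = 0;
  supertropical_nuD : {morph nu : a b / a + b};
  supertropical_nuM : {morph nu : a b / a * b};
  supertropical_nu_idem : forall a, nu (nu a) = nu a;
  supertropical_addxx : forall a, a + a = nu a;
  supertropical_add_neq :
    forall a b, nu a <> nu b -> a + b = a \/ a + b = b;
  supertropical_add_eq : forall a b, nu a = nu b -> a + b = nu a
}.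

Definition tangible (R : comPzSemiRingType) (G0 : {pred R}) : {pred R} :=
  [pred a | a \notin G0].

(* G, where G_0 is G with the zero element adjoined. *)
Definition nonzero_ghost (R : comPzSemiRingType) (G0 : {pred R}) : {pred R} :=
  [pred a | (a \in G0) && (a != 0)].

Record supertropical_domain (R : comPzSemiRingType)
    (G0 : {pred R}) (nu : R -> R) : Prop := SupertropicalDomain {
  domain_supertropical : supertropical_semiring G0 nu;
  domain_tangible1 : 1 \in tangible G0;
  domain_tangibleM : {in tangible G0 &, forall a b, a * b \in tangible G0};
  domain_nu_tangible :
    {in tangible G0, forall a, nu a \in nonzero_ghost G0};
  domain_nu_onto :
    {in nonzero_ghost G0, forall g, exists2 a, a \in tangible G0 & nu a = g}
}.

Record supertropical_semifield (R : comPzSemiRingType)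
    (G0 : {pred R}) (nu : R -> R) : Prop := SupertropicalSemifield {
  semifield_domain : supertropical_domain G0 nu;
  semifield_tangibleV :
    {in tangible G0, forall a, exists2 b, b \in tangible G0 & a * b = 1}
}.

(* The underlying set of the divisible closure: formal roots [(a, m)], standing
   for the m-th root of [a], modulo [same_root].  Its operations are not needed
   to say that it coincides with R. *)
Section DivisibleClosure.
Variable R : comPzSemiRingType.

Definition formal_root : Type := (R * {m : nat | (0 < m)%N})%type.

Definition same_root (x y : formal_root) : Prop :=
  exists2 n : nat, (0 < n)%N &
    x.1 ^+ (val y.2 * n) = y.1 ^+ (val x.2 * n).

Definition same_rootb (x y : formal_root) : bool := `[< same_root x y >].

Lemma same_rootb_equiv : equiv_class_of same_rootb.
Proof.
split=> [x|x y|y x z].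
- by apply/asboolP; exists 1%N.
- by apply/asboolP/asboolP => -[n n0 e]; exists n.
move=> /asboolP[n n0 exy] /asboolP[k k0 eyz]; apply/asboolP.
exists (val y.2 * n * k)%N; first by rewrite !muln_gt0 n0 k0 (valP y.2).
transitivity (y.1 ^+ (val x.2 * n) ^+ (val z.2 * k)).
  by rewrite -exy -exprM; congr (_ ^+ _); ring.
rewrite -exprM; transitivity (y.1 ^+ (val z.2 * k) ^+ (val x.2 * n)).
  by rewrite -exprM; congr (_ ^+ _); ring.
by rewrite eyz -exprM; congr (_ ^+ _); ring.
Qed.

Canonical same_root_equiv := EquivRelPack same_rootb_equiv.

Definition divisible_closure := {eq_quot same_root_equiv}.

Definition root_of (m : {m : nat | (0 < m)%N}) (a : R) : divisible_closure :=
  \pi_divisible_closure (a, m).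

Lemma root_ofP m m' a b :
  root_of m a = root_of m' b <->
  exists2 n : nat, (0 < n)%N & a ^+ (val m' * n) = b ^+ (val m * n).
Proof.
split=> [/eqquotP/asboolP //|e].
by apply/eqquotP/asboolP.
Qed.

Definition closure_emb (a : R) : divisible_closure :=
  root_of (exist _ 1%N isT) a.

(* The closure equals R, elements [a] of R being identified with their formal
   first roots.  [closure_emb a] = [closure_emb b] iff [a ^+ n = b ^+ n] for
   some [n > 0], so elements with a common power are identified; that such
   elements be equal (injectivity of [closure_emb]) is not required. *)
Definition divisibly_closed : Prop :=
  forall x : divisible_closure, exists a : R, x = closure_emb a.

End DivisibleClosure.

Definition tangible_monomial (F : comNzSemiRingType) (G0 : {pred F})
    (f : {poly F}) : Prop :=
  exists2 alpha : F, alpha \in tangible G0 &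
    exists i : nat, f = alpha%:P * 'X^i.

Definition supertropical_root (F : comNzSemiRingType) (G0 : {pred F})
    (f : {poly F}) (a : F) : Prop := f.[a] \in G0.

(* Main.v *)
Require Import Defs.
From mathcomp Require Import all_boot all_order all_algebra.
From mathcomp Require Import ring.

(** Order F by the size of the ghost value: a is dominated by b when
    [nu a + nu b = nu b].  This is a total preorder, compatible with the semiring
    operations, and tangible factors can be cancelled from it.  A sum is ghost as
    soon as its dominant value is attained by two of its terms
    ([ghost_sum_tie]), so a root of f is found by letting two monomials tie above
    all the others: a corner of the tropical polynomial.

    If f has at most one nonzero coefficient, its coefficients are all ghost by
    hypothesis, and every tangible element is a root.  Otherwise let
    [f`_i * X^i] be the monomial of lowest degree.  For each other nonzero
    coefficient [f`_k], k > i, replace both coefficients by tangible elements of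
    the same ghost value and extract a (k - i)-th root of their quotient; since
    taking powers is injective on ghost values ([nuX_inj]), this yields a
    tangible c_k at which the monomials of degree i and k tie ([exists_tie]).
    Below c_k the monomial of lower degree dominates ([dominated_before_tie]).  Hence at the least of the
    c_k the monomial of degree i dominates all others and ties with one of them
    ([exists_first_tie]): the least c_k is the first corner of f. *)

Set Implicit Arguments.
Unset Strict Implicit.
Unset Printing Implicit Defensive.

Import GRing.Theory.

Local Open Scope ring_scope.

(** * The preorder given by ghost values *)

Definition dominated (R : comPzSemiRingType) (nu : R -> R) (a b : R) : Prop :=
  nu a + nu b = nu b.

Section Supertropical.
Variables (R : comPzSemiRingType) (G0 : {pred R}) (nu : R -> R).
Hypothesis hR : supertropical_semiring G0 nu.

Let nuD := supertropical_nuD hR.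
Let nuM := supertropical_nuM hR.
Let nuK := supertropical_nu_idem hR.

Lemma dominated_eq a b : nu a = nu b -> dominated nu a b.
Proof.
by move=> eab; rewrite /dominated eab (supertropical_addxx hR) nuK.
Qed.

Lemma dominated_total a b : dominated nu a b \/ dominated nu b a.
Proof.
have [eab|/eqP neab] := eqVneq (nu a) (nu b).
  by left; apply: dominated_eq.
have := @supertropical_add_neq _ _ _ hR (nu a) (nu b).
rewrite !nuK => /(_ neab)[] e; [right|left] => //.
by rewrite /dominated addrC.
Qed.

Lemma dominated_trans b a c :
  dominated nu a b -> dominated nu b c -> dominated nu a c.
Proof. by rewrite /dominated => ab bc; rewrite -bc addrA ab. Qed.

Lemma dominated_anti a b : dominated nu a b -> dominated nu b a -> nu a = nu b.
Proof. by rewrite /dominated => ab ba; rewrite -ab addrC. Qed.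

Lemma dominated0 a : dominated nu 0 a.
Proof. by rewrite /dominated (supertropical_nu0 hR) add0r. Qed.

Lemma dominatedD a b c :
  dominated nu a c -> dominated nu b c -> dominated nu (a + b) c.
Proof. by rewrite /dominated nuD => ac bc; rewrite -addrA bc. Qed.

Lemma dominatedM c a b : dominated nu a b -> dominated nu (c * a) (c * b).
Proof. by rewrite /dominated !nuM -mulrDr => ->. Qed.

Lemma dominatedX n a b : dominated nu a b -> dominated nu (a ^+ n) (b ^+ n).
Proof.
move=> ab; elim: n => [|n IHn]; first exact: dominated_eq.
apply: (@dominated_trans (a * b ^+ n)); rewrite !exprS; first exact: dominatedM.
by rewrite ![_ * b ^+ n]mulrC; apply: dominatedM.
Qed.

Lemma ghost_addr a b : a \in G0 -> dominated nu b a -> a + b \in G0.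
Proof.
move=> aG ba; have [eab|/eqP neab] := eqVneq (nu a) (nu b).
  by rewrite (supertropical_add_eq hR eab) (supertropical_nu_ghost hR).
have [->//|eb] := supertropical_add_neq hR neab.
case: neab; apply: dominated_anti ba.
by rewrite /dominated -nuD eb.
Qed.

(** The two tied terms add up to their common ghost value, and adding terms that
    it dominates keeps it ghost. *)
Lemma ghost_sum_tie (I : finType) (x : I -> R) (i j : I) :
    j != i -> nu (x i) = nu (x j) -> (forall k, dominated nu (x k) (x i)) ->
  \sum_k x k \in G0.
Proof.
move=> ji eij dom; rewrite (bigD1 i) //= (bigD1 j) //= addrA.
rewrite (supertropical_add_eq hR eij).
apply: ghost_addr; first exact: (supertropical_nu_ghost hR).
apply: (@dominated_trans (x i)); last by apply: dominated_eq; rewrite nuK.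
by elim/big_ind: _ => //; [apply: dominated0 | move=> a b; apply: dominatedD].
Qed.

End Supertropical.

(** * Ties between monomials over a semifield *)

Section Semifield.
Variables (F : comPzSemiRingType) (G0 : {pred F}) (nu : F -> F).
Hypothesis hF : supertropical_semifield G0 nu.

Let hD := semifield_domain hF.
Let hR := domain_supertropical hD.
Let nuM := supertropical_nuM hR.

Lemma tangibleX a n : a \in tangible G0 -> a ^+ n \in tangible G0.
Proof.
move=> aT; elim: n => [|n IHn]; first exact: domain_tangible1 hD.
by rewrite exprS; apply: (domain_tangibleM hD).
Qed.

Lemma dominated_cancel c a b : c \in tangible G0 ->
  dominated nu (c * a) (c * b) -> dominated nu a b.
Proof.
move=> /(semifield_tangibleV hF)[d _ cd] /(dominatedM hR d).
by rewrite !mulrA [d * c]mulrC cd !mul1r.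
Qed.

(** The order being total, a may be taken below b.  Then [b * b^n] is dominated
    by [a * a^n], hence by [a * b^n], and [b^n] cancels. *)
Lemma dominatedX_cancel a b n : b \in tangible G0 ->
  dominated nu (b ^+ n.+1) (a ^+ n.+1) -> dominated nu b a.
Proof.
move=> bT baX; have [ab|//] := dominated_total hR a b.
apply: (dominated_cancel (tangibleX n bT)); rewrite -exprSr.
apply: (dominated_trans baX); rewrite exprSr ![_ * a]mulrC.
exact/(dominatedM hR)/(dominatedX hR).
Qed.

Lemma nuX_inj a b n : a \in tangible G0 -> b \in tangible G0 -> (0 < n)%N ->
  nu (a ^+ n) = nu (b ^+ n) -> nu a = nu b.
Proof.
case: n => // n aT bT _ eabX.
by apply: dominated_anti; apply: dominatedX_cancel (dominated_eq hR _); eauto.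
Qed.

Lemma tangible_lift a : a != 0 -> exists2 b, b \in tangible G0 & nu b = nu a.
Proof.
move=> a0; have [aG|aT] := boolP (a \in G0); last by exists a.
have [|b bT eb] := domain_nu_onto hD (x := a); first by rewrite inE aG.
by exists b; rewrite // -eb (supertropical_nu_idem hR).
Qed.

Hypothesis hdiv : divisibly_closed F.

(** Divisible closure only provides c with [c^(m n) = b^n] for some n; passing to
    ghost values removes the exponent n. *)
Lemma exists_nu_root b m : b \in tangible G0 -> (0 < m)%N ->
  exists2 c, c \in tangible G0 & nu (c ^+ m) = nu b.
Proof.
move=> bT m0; have [c] := hdiv (root_of (exist _ m m0) b).
move=> /root_ofP[n n0]; rewrite /= mul1n => e.
have cT : c \in tangible G0.
  apply/negP => cG; have := tangibleX n bT; rewrite e inE /= => /negP; apply.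
  have := muln_gt0 m n; rewrite m0 n0; case: (m * n)%N => // k _.
  by rewrite exprSr; apply: (supertropical_idealM hR).
exists c => //; apply: (nuX_inj (tangibleX m cT) bT n0).
by rewrite -exprM e.
Qed.

Lemma exists_tie a b i k : a != 0 -> b != 0 -> (i < k)%N ->
  exists2 c, c \in tangible G0 & nu (a * c ^+ i) = nu (b * c ^+ k).
Proof.
move=> /tangible_lift[a' a'T ea] /tangible_lift[b' b'T eb] ik.
have [d dT b'd] := semifield_tangibleV hF b'T.
(* d is the inverse of b', so c is to be a (k - i)-th root of a' / b'. *)
have [||c cT ec] := @exists_nu_root (a' * d) (k - i); rewrite ?subn_gt0 //.
  exact: (domain_tangibleM hD).
exists c => //; rewrite -(subnK (ltnW ik)) exprD !nuM -ea -eb ec -!nuM.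
by rewrite -{1}[a']mul1r -b'd; congr nu; ring.
Qed.

(** The terms are equal in ghost value at d, and moving the argument down to c
    multiplies the one of degree k by an extra factor [(c / d)^(k - i)]. *)
Lemma dominated_before_tie a b i k c d : (i <= k)%N -> d \in tangible G0 ->
    dominated nu c d -> nu (a * d ^+ i) = nu (b * d ^+ k) ->
  dominated nu (b * c ^+ k) (a * c ^+ i).
Proof.
move=> /subnK <-; set m := (k - i)%N => dT cd e.
(* Cross-multiplying by the k-th powers of d and c brings in the tie. *)
apply: (dominated_cancel (tangibleX (m + i) dT)).
apply: (@dominated_trans _ _ (c ^+ (m + i) * (a * d ^+ i))).
  apply: (dominated_eq hR); rewrite (nuM _ (a * _)) e -nuM.
  by congr nu; ring.
rewrite !exprD.
have -> : c ^+ m * c ^+ i * (a * d ^+ i) = a * c ^+ i * d ^+ i * c ^+ m by ring.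
have -> : d ^+ m * d ^+ i * (a * c ^+ i) = a * c ^+ i * d ^+ i * d ^+ m by ring.
exact/(dominatedM hR)/(dominatedX hR).
Qed.

(** Ties are collected one degree at a time. A new tie located after c leaves the
    point c valid; one located before c becomes the new point, and the terms
    met so far stay dominated there because c is itself located before their
    ties. The invariant therefore bounds the terms at every point d below c. *)
Lemma exists_first_tie (alpha : nat -> F) (i n : nat) : alpha i != 0 ->
  (forall k, (i < k <= n)%N -> alpha k = 0) \/
  exists2 c, c \in tangible G0 &
    (exists2 j, (i < j <= n)%N &
      nu (alpha i * c ^+ i) = nu (alpha j * c ^+ j)) /\
    (forall k d, (i < k <= n)%N -> dominated nu d c ->
      dominated nu (alpha k * d ^+ k) (alpha i * d ^+ i)).
Proof.
move=> ai0; elim: n => [|n IHn].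
  by left=> k /andP[ik k0]; move: (leq_trans ik k0).
have splitS k : (i < k <= n.+1)%N -> (i < k <= n)%N \/ k = n.+1.
  by case/andP=> ->; rewrite leq_eqVlt => /predU1P[->|]; [right|left].
have widen k : (i < k <= n)%N -> (i < k <= n.+1)%N.
  by case/andP=> -> /leqW.
have [an0|an0] := eqVneq (alpha n.+1) 0.
  case: IHn => [all0|[c cT [[j jn ej] dom]]]; [left|right].
    by move=> k /splitS[/all0|->].
  exists c => //; split; first by exists j; rewrite ?widen.
  move=> k d /splitS[kn|->] dc; first exact: dom.
  by rewrite an0 mul0r; apply: (dominated0 hR).
have [ni|iSn] := leqP n.+1 i.
  by left=> k /andP[ik kn]; have := leq_trans ik (leq_trans kn ni); rewrite ltnn.
have [c' c'T e'] := exists_tie ai0 an0 iSn.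
have dom' d : dominated nu d c' ->
    dominated nu (alpha n.+1 * d ^+ n.+1) (alpha i * d ^+ i).
  by move=> dc'; apply: dominated_before_tie e'; rewrite // ltnW.
have tie' : exists2 j, (i < j <= n.+1)%N &
    nu (alpha i * c' ^+ i) = nu (alpha j * c' ^+ j).
  by exists n.+1; rewrite ?iSn /=.
right; case: IHn => [all0|[c cT [[j jn ej] dom]]].
  exists c' => //; split=> // k d /splitS[/all0 ->|->] dc'; last exact: dom'.
  by rewrite mul0r; apply: (dominated0 hR).
have [cc'|c'c] := dominated_total hR c c'.
  exists c => //; split; first by exists j; rewrite ?widen.
  move=> k d /splitS[kn|->] dc; first exact: dom.
  exact/dom'/(dominated_trans dc).
exists c' => //; split=> // k d /splitS[kn|->] dc'; last exact: dom'.
exact/dom/(dominated_trans dc').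
Qed.

End Semifield.

(** * Roots of polynomials *)

Theorem proposition5p9 (F : comNzSemiRingType) (G0 : {pred F}) (nu : F -> F)
    (hF : supertropical_semifield G0 nu) (hdiv : divisibly_closed F)
    (f : {poly F}) (hf : ~ tangible_monomial G0 f) :
  exists2 a : F, a \in tangible G0 & supertropical_root G0 f a.
Proof.
have hR := domain_supertropical (semifield_domain hF).
have T1 := domain_tangible1 (semifield_domain hF).
have [->|f0] := eqVneq f 0.
  by exists 1; rewrite // /supertropical_root horner0 (supertropical_ideal0 hR).
have exf : exists i, f`_i != 0.
  by exists (size f).-1; rewrite -lead_coefE lead_coef_eq0.
case: (ex_minnP exf) => i fi0 imin.
have below k : (k < i)%N -> f`_k = 0.
  by apply: contraTeq => /imin; rewrite -leqNgt.
have isz : (i < size f)%N by rewrite ltnNge; apply: contra fi0 => /leq_sizeP->.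
have [above|[c cT [[j /andP[ij jsz] tie] dom]]] :=
  exists_first_tie hF hdiv (size f) fi0.
  have fE : f = (f`_i)%:P * 'X^i.
    apply/polyP => k; rewrite coefCM coefXn.
    have [-> | neq_ki] := eqVneq k i; first by rewrite mulr1.
    rewrite mulr0; case: (ltngtP k i) neq_ki => [/below //|ik _|-> /eqP//].
    have [ksz|ksz] := leqP k (size f); first by apply: above; rewrite ik.
    by rewrite nth_default // ltnW.
  have fiG : f`_i \in G0.
    by apply: contra_notT hf => fiT; exists f`_i => //; exists i.
  by exists 1; rewrite // /supertropical_root fE hornerCM hornerXn expr1n mulr1.
(* The bound [size f] on the index is inclusive, hence one extra zero term. *)
exists c => //; rewrite /supertropical_root (@horner_coef_wide _ (size f).+1) //.
apply: (@ghost_sum_tie _ _ _ hR _ _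
          (Ordinal (leqW isz)) (@Ordinal (size f).+1 j jsz)).
- by rewrite -val_eqE /= gtn_eqF.
- exact: tie.
move=> /= k; have [ki|ik|->] := ltngtP k i.
- by rewrite below // mul0r; apply: (dominated0 hR).
- by apply: dom; [rewrite ik -ltnS ltn_ord | apply: (dominated_eq hR)].
exact: (dominated_eq hR).
Qed.
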